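(* Let $R$ be an associative ring with unity $1$, and let $a,b\in R$ be Drazin invertible elements with $a^2b=aba$ and $b^2a=bab$. Then $ab$ is Drazin invertible and $(ab)^D=a^Db^D$.
   Context: An element $a\in R$ is Drazin invertible if there exists $x\in R$ such that $ax=xa$, $xax=x$ and $a^k=a^{k+1}x$ for some positive integer $k$; such an $x$ is unique and is denoted $a^D$ (the Drazin inverse of $a$). *)

(* Defs.v *)
From mathcomp Require Import all_boot all_algebra.
From mathcomp Require Import boolp classical_sets.

Set Implicit Arguments.
Unset Strict Implicit.
Unset Printing Implicit Defensive.
Import GRing.Theory.
Local Open Scope ring_scope.

Definition is_drazin_inverse (R : pzRingType) (a x : R) : Prop :=
  [/\ a * x = x * a,
      x * a * x = x &
      exists2 k : nat, (0 < k)%N & a ^+ k = a ^+ k.+1 * x].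

Definition drazin_invertible (R : pzRingType) (a : R) : Prop :=
  exists x : R, is_drazin_inverse a x.

(* Total function: the value is the junk 0 when a is not Drazin invertible;
   otherwise it is pinned down by drazin_inverseP and
   is_drazin_inverse_unique below. *)
Definition drazin_inverse (R : pzRingType) (a : R) : R :=
  xget 0 [set x | is_drazin_inverse a x]%classic.

Lemma drazin_inverseP (R : pzRingType) (a : R) :
  drazin_invertible a -> is_drazin_inverse a (drazin_inverse a).
Proof. by move=> [x ax]; exact: (@xgetI _ 0 [set x | _]%classic x ax). Qed.

Lemma is_drazin_inverse_unique (R : pzRingType) (a x y : R) :
  is_drazin_inverse a x -> is_drazin_inverse a y -> x = y.
Proof.
have expand (z : R) n : a * z = z * a -> z * a * z = z ->
    z = z ^+ n.+1 * a ^+ n.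
  move=> az zaz; have zza : z = z * z * a by rewrite -mulrA -az mulrA zaz.
  elim: n => [|n IHn]; first by rewrite expr1 expr0 mulr1.
  rewrite {1}IHn [a ^+ n.+1]exprS [z ^+ n.+2]exprSr [z ^+ n.+1]exprSr.
  by rewrite mulrA -(mulrA _ z z) -(mulrA _ (z * z) a) -zza.
move=> [ax xax [k _ ak]] [ay yay [l _ al]].
have -> : x = x * a * y.
  by rewrite {1}(expand x l ax xax) al [a ^+ _.+1]exprSr !mulrA -(expand x l ax xax).
have ka n : GRing.comm (a ^+ n) x by apply/commr_sym/commrX/esym.
have ky n : GRing.comm (y ^+ n) (a ^+ k).
  by apply/commrX/commr_sym/commrX/esym.
rewrite [RHS](expand y k ay yay) ky ak ka [a ^+ _.+1]exprS -!mulrA -ky.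
by rewrite -(expand y k ay yay).
Qed.

(* Main.v *)
(** Write [x] and [y] for the Drazin inverses of [a] and [b]. Since [a] commutes
    with [a * b], so does [x], and [(a * b) ^+ n = a ^+ n * b ^+ n]; likewise [y]
    commutes with [b * a]. From [x = x * x * a] one gets [x * b * a = x * a * b],
    and dually [y * a = b * a * y * y]. These relations make [x * y] commute with
    [a], hence with [x]; each Drazin axiom for [x * y] then reduces to those for
    [x] and [y]. *)
Require Import Defs.
From mathcomp Require Import all_boot all_algebra.
Import GRing.Theory.
Local Open Scope ring_scope.

Lemma outer_inverse_expand (R : pzRingType) (a x : R) n :
  a * x = x * a -> x * a * x = x -> x = x ^+ n.+1 * a ^+ n.
Proof.
move=> ax xax; have xxa : x * x * a = x by rewrite -mulrA -ax mulrA.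
elim: n => [|n IHn]; first by rewrite expr1 expr0 mulr1.
rewrite {1}IHn [a ^+ n.+1]exprS [x ^+ n.+2]exprSr [x ^+ n.+1]exprSr.
by rewrite [RHS]mulrA -(mulrA _ x x) -(mulrA _ (x * x) a) xxa.
Qed.

(** Writing [x] as [x ^+ k.+1 * a ^+ k], in either order, puts [a ^+ k] next to [c]; it moves across
    [c] and absorbs [a * x]. So [x * c] and [c * x] both equal [x * a * c * x]. *)
Lemma drazin_inverse_comm (R : pzRingType) (a x c : R) :
  is_drazin_inverse a x -> a * c = c * a -> x * c = c * x.
Proof.
move=> [ax xax [k _ ak]] ac.
have xE := @outer_inverse_expand R a x k ax xax.
have akc : a ^+ k * c = c * a ^+ k by apply/commr_sym/commrX/esym.
have akx : x * a ^+ k = a ^+ k * x by apply/commrX/esym.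
have xE' : x = a ^+ k * x ^+ k.+1 by rewrite {1}xE; apply/commrX/commr_sym/commrX.
have akax : a ^+ k * (a * x) = a ^+ k by rewrite mulrA -exprSr.
have axak : a * x * a ^+ k = a ^+ k by rewrite -mulrA akx mulrA -exprS.
have -> : x * c = x * c * (a * x).
  by rewrite [in x * c]xE -!(mulrA (x ^+ _)) akc -(mulrA c) akax.
have -> : c * x = a * x * c * x.
  rewrite -(mulrA _ c) [in c * x]xE' (mulrA c) -akc.
  by rewrite mulrA (mulrA _ (a ^+ k)) axak.
by rewrite mulrA -(mulrA x c) -ac mulrA -ax.
Qed.

Lemma exprM_comm_mul (R : pzRingType) (a b : R) n :
  a * (a * b) = a * b * a -> (a * b) ^+ n = a ^+ n * b ^+ n.
Proof.
move=> aab; elim: n => [|n IHn]; first by rewrite !expr0 mulr1.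
have abna : a * (a * b) ^+ n = (a * b) ^+ n * a by apply/commrX.
by rewrite exprSr mulrA -abna IHn exprS exprSr !mulrA.
Qed.

(** Lets the index equations of [a] and [b] be used at a common exponent. *)
Lemma drazin_index_addl (R : pzRingType) (a x : R) k m :
  a ^+ k = a ^+ k.+1 * x -> a ^+ (m + k) = a ^+ (m + k).+1 * x.
Proof. by move=> ak; rewrite -addnS !exprD {1}ak mulrA. Qed.

Lemma outer_inverse_mulr (R : pzRingType) (a b x : R) :
  a * x = x * a -> x * a * x = x -> x * (a * b) = a * b * x ->
  x * b = a * b * (x * x).
Proof.
move=> ax xax xab.
have xE : x = x * x * a by rewrite -mulrA -ax mulrA.
by rewrite {1}xE -mulrA -[LHS]mulrA xab mulrA xab mulrA.
Qed.

Lemma is_drazin_inverse_mul (R : pzRingType) (a b x y : R) :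
  a * (a * b) = a * b * a -> b * (b * a) = b * a * b ->
  is_drazin_inverse a x -> is_drazin_inverse b y ->
  is_drazin_inverse (a * b) (x * y).
Proof.
move=> aab bba dx dy.
have xab := @drazin_inverse_comm R a x (a * b) dx aab.
have yba := @drazin_inverse_comm R b y (b * a) dy bba.
have [ax xax [k k0 ak]] := dx; have [bby yby [l _ bl]] := dy.
have xb := @outer_inverse_mulr R a b x ax xax xab.
have ya := @outer_inverse_mulr R b a y bby yby yba.
have xxa : x * x * a = x by rewrite -mulrA -ax mulrA.
have byy : b * (y * y) = y by rewrite mulrA bby.
have xba : x * (b * a) = a * b * x by rewrite mulrA xb -mulrA xxa.
(* [x * y * a = x * b * a * y * y = x * a * b * y * y = a * x * y]. *)
have axy : a * (x * y) = x * y * a.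
  by rewrite -[RHS]mulrA ya [RHS]mulrA xba -xab !mulrA -ax -!mulrA byy.
have xxy : x * (x * y) = x * y * x := @drazin_inverse_comm R a x _ dx axy.
have abxy : a * b * (x * y) = x * (a * (b * y)) by rewrite mulrA -xab !mulrA.
have xyab : x * y * (a * b) = a * b * (x * y).
  rewrite abxy [LHS]mulrA -axy -mulrA -(mulrA x y b) -bby.
  by rewrite [LHS]mulrA ax -mulrA.
split=> //.
(* The product becomes [a * b * x * x * y * y], then [x * x * a * b * y * y], which collapses from
   both ends to [x * y]. *)
- rewrite xyab -mulrA (mulrA (x * y)) -xxy -!mulrA (mulrA a) mulrA -xab.
  by rewrite -mulrA (mulrA _ x) -xab -!mulrA byy mulrA mulrA xxa.
(* The sum bounds both indices, so after splitting [(a * b) ^+ (k + l).+1] into powers, [x] lowers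
   the exponent of [a] and [y] that of [b]. *)
- exists (k + l)%N; first by rewrite addn_gt0 k0.
  have xabn : x * (a * b) ^+ (k + l).+1 = (a * b) ^+ (k + l).+1 * x by apply/commrX.
  have xan : x * a ^+ (k + l).+1 = a ^+ (k + l).+1 * x by apply/commrX/esym.
  rewrite mulrA -xabn !exprM_comm_mul // mulrA xan -[RHS]mulrA.
  by rewrite -(@drazin_index_addl R b y l k) // addnC -(@drazin_index_addl R a x k l).
Qed.

Theorem theorem3p1 (R : pzRingType) (a b : R)
    (ha : drazin_invertible a) (hb : drazin_invertible b)
    (hab : a ^+ 2 * b = a * b * a) (hba : b ^+ 2 * a = b * a * b) :
  drazin_invertible (a * b) /\
  drazin_inverse (a * b) = drazin_inverse a * drazin_inverse b.
Proof.
have dab : is_drazin_inverse (a * b) (drazin_inverse a * drazin_inverse b).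
  by apply: is_drazin_inverse_mul; rewrite ?mulrA -?expr2 //;
    exact: drazin_inverseP.
(* This makes [drazin_inverse (a * b)] a true inverse rather than the default [0], so uniqueness
   applies. *)
have iab : drazin_invertible (a * b) by exists (drazin_inverse a * drazin_inverse b).
by split=> //; apply: is_drazin_inverse_unique (drazin_inverseP iab) dab.
Qed.
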